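(* For each of the following sets $P$ of five generalized patterns, $|S_n(P)|=n$ for every $n\ge1$: $\{1\text{-}23,2\text{-}13,31\text{-}2,21\text{-}3,3\text{-}12\}$, $\{1\text{-}23,2\text{-}13,2\text{-}31,21\text{-}3,23\text{-}1\}$, $\{12\text{-}3,31\text{-}2,2\text{-}13,21\text{-}3,3\text{-}12\}$, $\{1\text{-}23,2\text{-}31,31\text{-}2,23\text{-}1,3\text{-}12\}$, $\{2\text{-}13,2\text{-}31,1\text{-}32,23\text{-}1,21\text{-}3\}$, $\{2\text{-}13,2\text{-}31,13\text{-}2,23\text{-}1,21\text{-}3\}$, $\{2\text{-}13,2\text{-}31,13\text{-}2,21\text{-}3,1\text{-}32\}$, $\{2\text{-}13,23\text{-}1,13\text{-}2,1\text{-}32,21\text{-}3\}$, $\{2\text{-}13,2\text{-}31,13\text{-}2,1\text{-}32,23\text{-}1\}$, $\{2\text{-}31,21\text{-}3,13\text{-}2,23\text{-}1,1\text{-}32\}$, $\{1\text{-}23,2\text{-}13,2\text{-}31,21\text{-}3,12\text{-}3\}$, $\{1\text{-}23,2\text{-}13,23\text{-}1,21\text{-}3,12\text{-}3\}$, $\{1\text{-}23,2\text{-}13,3\text{-}12,21\text{-}3,12\text{-}3\}$, $\{1\text{-}23,2\text{-}13,31\text{-}2,21\text{-}3,12\text{-}3\}$, $\{1\text{-}23,2\text{-}13,2\text{-}31,23\text{-}1,12\text{-}3\}$, $\{1\text{-}23,2\text{-}13,31\text{-}2,3\text{-}12,12\text{-}3\}$, $\{1\text{-}23,21\text{-}3,2\text{-}31,23\text{-}1,12\text{-}3\}$,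 $\{1\text{-}23,21\text{-}3,31\text{-}2,3\text{-}12,12\text{-}3\}$, $\{1\text{-}23,2\text{-}31,3\text{-}12,23\text{-}1,12\text{-}3\}$, $\{1\text{-}23,2\text{-}31,31\text{-}2,23\text{-}1,12\text{-}3\}$.
   Context: $S_n$ is the set of permutations $\pi=\pi_1\pi_2\cdots\pi_n$ of $\{1,\dots,n\}$. For $abc$ a permutation of $123$, the generalized pattern $a\text{-}bc$ is contained in $\pi$ if there are indices $i<j$ with $j+1\le n$ such that $\pi_i\pi_j\pi_{j+1}$ is order-isomorphic to $abc$; the generalized pattern $ab\text{-}c$ is contained in $\pi$ if there are indices $i,k$ with $i+1<k\le n$ such that $\pi_i\pi_{i+1}\pi_k$ is order-isomorphic to $abc$. (Letters not separated by a dash must occur in adjacent positions; letters separated by a dash need not be adjacent.) $\pi$ avoids a pattern if it does not contain it. For a set $P$ of generalized patterns, $S_n(P)$ is the set of $\pi\in S_n$ avoiding every pattern in $P$. *)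

(* Defs.v *)
From mathcomp Require Import all_boot all_fingroup.
Set Implicit Arguments.
Unset Strict Implicit.
Unset Printing Implicit Defensive.

(* DashAfter1 a b c is the pattern a-bc, DashAfter2 a b c is ab-c. *)
Inductive gpattern : Type :=
  | DashAfter1 (a b c : nat) of perm_eq [:: a; b; c] [:: 1; 2; 3]
  | DashAfter2 (a b c : nat) of perm_eq [:: a; b; c] [:: 1; 2; 3].

Notation "[ 'gp' a - b c ]" := (@DashAfter1 a b c isT)
  (at level 0, a at level 0, b at level 0, c at level 0,
   format "[ 'gp'  a  -  b  c ]").
Notation "[ 'gp' a b - c ]" := (@DashAfter2 a b c isT)
  (at level 0, a at level 0, b at level 0, c at level 0,
   format "[ 'gp'  a  b  -  c ]").

Definition order_iso (u v : seq nat) : bool :=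
  (size u == size v) &&
  all (fun i => all (fun j =>
         (nth 0 u i < nth 0 u j) == (nth 0 v i < nth 0 v j))
       (iota 0 (size u))) (iota 0 (size u)).

(* 'S_n permutes {0, ..., n-1} rather than {1, ..., n}; shifting positions and
   values by one does not affect adjacency or relative order. *)
Definition contains (n : nat) (s : 'S_n) (p : gpattern) : bool :=
  match p with
  | DashAfter1 a b c _ =>
      [exists i : 'I_n, exists j : 'I_n, exists k : 'I_n,
        [&& i < j, k == j.+1 :> nat
          & order_iso [:: (s i : nat); (s j : nat); (s k : nat)] [:: a; b; c]]]
  | DashAfter2 a b c _ =>
      [exists i : 'I_n, exists j : 'I_n, exists k : 'I_n,
        [&& j == i.+1 :> nat, j < k
          & order_iso [:: (s i : nat); (s j : nat); (s k : nat)] [:: a; b; c]]]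
  end.

Definition avoiders (n : nat) (P : seq gpattern) : {set 'S_n} :=
  [set s : 'S_n | all (fun p => ~~ contains s p) P].

(* Main.v *)
Require Import Defs.
From Stdlib Require List.
From mathcomp Require Import all_boot all_fingroup.
From mathcomp Require Import zify.

(** Avoiding any of these sets of generalized patterns is the same as avoiding
    the three underlying classical patterns of one of the sets {123, 213, 312},
    {123, 213, 231}, {123, 231, 312}, {132, 213, 231}.  Given a classical
    occurrence whose two letters at positions [j < k] should be adjacent, some
    adjacent pair of positions between them crosses a suitable height; either
    that pair completes an occurrence of the generalized pattern, or the letter
    it brings in produces another, already excluded classical pattern.

    For the last three sets the position [p] of the least letter determines all
    comparisons of the other letters, and each [p] does occur; for the first
    set (the inverse of the second) the first letter plays this role. *)

(** * Classical patterns of length three and their dashed versions *)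

Definition avoids_classical n (s : 'S_n) (v : seq nat) : bool :=
  [forall i : 'I_n, forall j : 'I_n, forall k : 'I_n,
    (i < j) && (j < k) ==> ~~ order_iso [:: s i : nat; s j : nat; s k : nat] v].

Definition classical_avoiders n (V : seq (seq nat)) : {set 'S_n} :=
  [set s : 'S_n | all (avoids_classical n s) V].

Definition underlying (p : gpattern) : seq nat :=
  match p with DashAfter1 a b c _ | DashAfter2 a b c _ => [:: a; b; c] end.

Lemma avoids_classicalP n (s : 'S_n) v :
  reflect (forall i j k : 'I_n, i < j -> j < k ->
             ~~ order_iso [:: s i : nat; s j : nat; s k : nat] v)
          (avoids_classical n s v).
Proof.
apply: (iffP idP) => [av i j k ij jk | av].
  by move/forallP/(_ i)/forallP/(_ j)/forallP/(_ k): av; rewrite ij jk.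
apply/forallP=> i; apply/forallP=> j; apply/forallP=> k.
by apply/implyP=> /andP[]; apply: av.
Qed.

Lemma order_iso123 x y z : order_iso [:: x; y; z] [:: 1; 2; 3] = (x < y < z).
Proof. by rewrite /order_iso /=; lia. Qed.
Lemma order_iso132 x y z : order_iso [:: x; y; z] [:: 1; 3; 2] = (x < z < y).
Proof. by rewrite /order_iso /=; lia. Qed.
Lemma order_iso213 x y z : order_iso [:: x; y; z] [:: 2; 1; 3] = (y < x < z).
Proof. by rewrite /order_iso /=; lia. Qed.
Lemma order_iso231 x y z : order_iso [:: x; y; z] [:: 2; 3; 1] = (z < x < y).
Proof. by rewrite /order_iso /=; lia. Qed.
Lemma order_iso312 x y z : order_iso [:: x; y; z] [:: 3; 1; 2] = (y < z < x).
Proof. by rewrite /order_iso /=; lia. Qed.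
Definition order_iso3E :=
  (order_iso123, order_iso132, order_iso213, order_iso231, order_iso312).

Lemma avoids_dash1 n (s : 'S_n) a b c abc :
  ~~ contains s (@DashAfter1 a b c abc) ->
  forall i j k : 'I_n, i < j -> k = j.+1 :> nat ->
  ~~ order_iso [:: s i : nat; s j : nat; s k : nat] [:: a; b; c].
Proof.
move=> av i j k ij jk; apply: contra av => iso.
apply/existsP; exists i; apply/existsP; exists j; apply/existsP; exists k.
by rewrite ij jk eqxx.
Qed.

Lemma avoids_dash2 n (s : 'S_n) a b c abc :
  ~~ contains s (@DashAfter2 a b c abc) ->
  forall i j k : 'I_n, j = i.+1 :> nat -> j < k ->
  ~~ order_iso [:: s i : nat; s j : nat; s k : nat] [:: a; b; c].
Proof.
move=> av i j k ij jk; apply: contra av => iso.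
apply/existsP; exists i; apply/existsP; exists j; apply/existsP; exists k.
by rewrite ij eqxx -ij jk.
Qed.

(** An occurrence of a dashed pattern is a classical occurrence with one extra adjacency. This is
    the inclusion valid for any set of patterns. *)
Lemma avoids_underlying n (s : 'S_n) p :
  avoids_classical n s (underlying p) -> ~~ contains s p.
Proof.
move=> /avoids_classicalP av; apply/negP.
case: p av => a b c abc /= av /existsP[i] /existsP[j] /existsP[k] /and3P[].
  by move=> ij /eqP jk iso; move: (av i j k ij); rewrite iso jk ltnSn => /(_ isT).
by move=> /eqP ij jk iso; move: (av i j k); rewrite iso jk ij ltnSn => /(_ isT isT).
Qed.

(** * From generalized avoidance to classical avoidance *)

(** A discrete intermediate value principle: moving right from [i], take the first position where
    [p] fails. Below, [p] says on which side of a given height a letter lies. *)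
Lemma adjacent_crossing {n} (p : pred 'I_n) {i j : 'I_n} :
  i < j -> p i -> ~~ p j ->
  exists t u : 'I_n, [/\ u = t.+1 :> nat, i <= t, u <= j, p t & ~~ p u].
Proof.
move=> ij pi npj.
have [m] := ubnP (j - i); elim: m i ij pi => // m IH i ij pi lt_m.
have lt_n : i.+1 < n by have := ltn_ord j; lia.
have [pu | npu] := boolP (p (Ordinal lt_n)); last first.
  by exists i, (Ordinal lt_n).
have uj : Ordinal lt_n < j.
  rewrite ltn_neqAle [X in _ && X]ij andbT; apply: contra npj => /eqP e.
  by rewrite (_ : j = Ordinal lt_n) //; apply/val_inj/esym.
have [|t [u [h1 h2 h3 h4 h5]]] := IH _ uj pu; first by move=> /=; lia.
by exists t, u; split=> //; apply: leq_trans h2 => /=.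
Qed.

Lemma perm_nat_eq {n} (s : 'S_n) (i j : 'I_n) :
  (s i == s j :> nat) = (i == j :> nat).
Proof. by rewrite !val_eqE (inj_eq perm_inj). Qed.

Section FromAdjacent.
Variables (n : nat) (s : 'S_n).
Implicit Types i j k : 'I_n.
Local Notation av := (avoids_classical n s).

(** In this pattern and the next three, the letter set apart by the dash has the middle value. An
    adjacent pair crossing its height, found between the other two letters, completes the dashed
    pattern at once. *)
Lemma avoids_213 : ~~ contains s [gp 2 - 1 3] -> av [:: 2; 1; 3].
Proof.
move=> /avoids_dash1 av1; apply/avoids_classicalP => i j k ij jk.
rewrite order_iso3E; apply/negP => /andP[h1 h2].
have [||t [u [h3 h4 h5 h6 h7]]] := adjacent_crossing (fun x => s x <= s i) jk.
- by lia.
- by lia.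
(* The predicate is not strict, but [t] lies to the right of [i], so [s t] differs from [s i]. *)
have := av1 i t u; rewrite order_iso3E.
have := perm_nat_eq s i t; lia.
Qed.

Lemma avoids_231 : ~~ contains s [gp 2 - 3 1] -> av [:: 2; 3; 1].
Proof.
move=> /avoids_dash1 av1; apply/avoids_classicalP => i j k ij jk.
rewrite order_iso3E; apply/negP => /andP[h1 h2].
have [||t [u [h3 h4 h5 h6 h7]]] := adjacent_crossing (fun x => s i < s x) jk.
- by lia.
- by lia.
have := av1 i t u; rewrite order_iso3E.
have := perm_nat_eq s i u; lia.
Qed.

Lemma avoids_312 : ~~ contains s [gp 3 1 - 2] -> av [:: 3; 1; 2].
Proof.
move=> /avoids_dash2 av1; apply/avoids_classicalP => i j k ij jk.
rewrite order_iso3E; apply/negP => /andP[h1 h2].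
have [||t [u [h3 h4 h5 h6 h7]]] := adjacent_crossing (fun x => s k < s x) ij.
- by lia.
- by lia.
have := av1 t u k; rewrite order_iso3E.
have := perm_nat_eq s k u; lia.
Qed.

Lemma avoids_132 : ~~ contains s [gp 1 3 - 2] -> av [:: 1; 3; 2].
Proof.
move=> /avoids_dash2 av1; apply/avoids_classicalP => i j k ij jk.
rewrite order_iso3E; apply/negP => /andP[h1 h2].
have [||t [u [h3 h4 h5 h6 h7]]] := adjacent_crossing (fun x => s x <= s k) ij.
- by lia.
- by lia.
have := av1 t u k; rewrite order_iso3E.
have := perm_nat_eq s k t; lia.
Qed.

(** The crossing at height [s j] gives [s t <= s j < s u]. If [s i < s t], then [i], [t], [u] form
    1-23; otherwise [i], [t], [k] form 213. The remaining lemmas of the section split in the same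
    way on the crossing letter that may be too low or too high. *)
Lemma avoids_123_of_213 :
  av [:: 2; 1; 3] -> ~~ contains s [gp 1 - 2 3] -> av [:: 1; 2; 3].
Proof.
move=> /avoids_classicalP av0 /avoids_dash1 av1.
apply/avoids_classicalP => i j k ij jk.
rewrite order_iso3E; apply/negP => /andP[h1 h2].
have [||t [u [h3 h4 h5 h6 h7]]] := adjacent_crossing (fun x => s x <= s j) jk.
- by lia.
- by lia.
have := av1 i t u; have := av0 i t k; rewrite !order_iso3E.
have := perm_nat_eq s i t; lia.
Qed.

Lemma avoids_123_of_231 :
  av [:: 2; 3; 1] -> ~~ contains s [gp 1 - 2 3] -> av [:: 1; 2; 3].
Proof.
move=> /avoids_classicalP av0 /avoids_dash1 av1.
apply/avoids_classicalP => i j k ij jk.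
rewrite order_iso3E; apply/negP => /andP[h1 h2].
have [||t [u [h3 h4 h5 h6 h7]]] := adjacent_crossing (fun x => s x <= s j) jk.
- by lia.
- by lia.
have := av1 i t u; have := av0 i j t; rewrite !order_iso3E.
have := perm_nat_eq s i t; have := perm_nat_eq s j t; lia.
Qed.

Lemma avoids_123_of_312 :
  av [:: 3; 1; 2] -> ~~ contains s [gp 1 2 - 3] -> av [:: 1; 2; 3].
Proof.
move=> /avoids_classicalP av0 /avoids_dash2 av1.
apply/avoids_classicalP => i j k ij jk.
rewrite order_iso3E; apply/negP => /andP[h1 h2].
have [||t [u [h3 h4 h5 h6 h7]]] := adjacent_crossing (fun x => s x < s j) ij.
- by lia.
- by lia.
(* Here the upper letter [s u] decides: below [s k] it gives 12-3, above [s k] it gives 312 with [j]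
   and [k]. *)
have := av1 t u k; have := av0 u j k; rewrite !order_iso3E.
have := perm_nat_eq s u k; have := perm_nat_eq s u j; lia.
Qed.

Lemma avoids_132_of_231 :
  av [:: 2; 3; 1] -> ~~ contains s [gp 1 - 3 2] -> av [:: 1; 3; 2].
Proof.
move=> /avoids_classicalP av0 /avoids_dash1 av1.
apply/avoids_classicalP => i j k ij jk.
rewrite order_iso3E; apply/negP => /andP[h1 h2].
have [||t [u [h3 h4 h5 h6 h7]]] := adjacent_crossing (fun x => s k < s x) jk.
- by lia.
- by lia.
have := av1 i t u; have := av0 i j u; rewrite !order_iso3E.
have := perm_nat_eq s i u; lia.
Qed.

Lemma avoids_231_of_213 :
  av [:: 2; 1; 3] -> ~~ contains s [gp 2 3 - 1] -> av [:: 2; 3; 1].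
Proof.
move=> /avoids_classicalP av0 /avoids_dash2 av1.
apply/avoids_classicalP => i j k ij jk.
rewrite order_iso3E; apply/negP => /andP[h1 h2].
have [||t [u [h3 h4 h5 h6 h7]]] := adjacent_crossing (fun x => s x < s j) ij.
- by lia.
- by lia.
have := av1 t u k; have := av0 i t j; rewrite !order_iso3E.
have := perm_nat_eq s i t; have := perm_nat_eq s t k; lia.
Qed.

Lemma avoids_213_of_231 :
  av [:: 2; 3; 1] -> ~~ contains s [gp 2 1 - 3] -> av [:: 2; 1; 3].
Proof.
move=> /avoids_classicalP av0 /avoids_dash2 av1.
apply/avoids_classicalP => i j k ij jk.
rewrite order_iso3E; apply/negP => /andP[h1 h2].
have [||t [u [h3 h4 h5 h6 h7]]] := adjacent_crossing (fun x => s i <= s x) ij.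
- by lia.
- by lia.
have := av1 t u k; have := av0 i t j; rewrite !order_iso3E.
have := perm_nat_eq s i t; have := perm_nat_eq s t k; lia.
Qed.

Lemma avoids_213_of_312 :
  av [:: 3; 1; 2] -> ~~ contains s [gp 2 1 - 3] -> av [:: 2; 1; 3].
Proof.
move=> /avoids_classicalP av0 /avoids_dash2 av1.
apply/avoids_classicalP => i j k ij jk.
rewrite order_iso3E; apply/negP => /andP[h1 h2].
have [||t [u [h3 h4 h5 h6 h7]]] := adjacent_crossing (fun x => s i <= s x) ij.
- by lia.
- by lia.
have := av1 t u k; have := av0 t j k; rewrite !order_iso3E.
have := perm_nat_eq s t k; lia.
Qed.

Lemma avoids_312_of_213 :
  av [:: 2; 1; 3] -> ~~ contains s [gp 3 - 1 2] -> av [:: 3; 1; 2].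
Proof.
move=> /avoids_classicalP av0 /avoids_dash1 av1.
apply/avoids_classicalP => i j k ij jk.
rewrite order_iso3E; apply/negP => /andP[h1 h2].
have [||t [u [h3 h4 h5 h6 h7]]] := adjacent_crossing (fun x => s x <= s j) jk.
- by lia.
- by lia.
(* If [s u] overshoots [s i], then [i], [j], [u] form 213. *)
have := av1 i t u; have := av0 i j u; rewrite !order_iso3E.
have := perm_nat_eq s i u; lia.
Qed.

Lemma avoids_312_of_231 :
  av [:: 2; 3; 1] -> ~~ contains s [gp 3 - 1 2] -> av [:: 3; 1; 2].
Proof.
move=> /avoids_classicalP av0 /avoids_dash1 av1.
apply/avoids_classicalP => i j k ij jk.
rewrite order_iso3E; apply/negP => /andP[h1 h2].
have [||t [u [h3 h4 h5 h6 h7]]] := adjacent_crossing (fun x => s x <= s j) jk.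
- by lia.
- by lia.
have := av1 i t u; have := av0 i u k; rewrite !order_iso3E.
have := perm_nat_eq s i u; have := perm_nat_eq s u k; lia.
Qed.

End FromAdjacent.

(** * Counting permutations by a label *)

Lemma perm_eq_of_comparisons {n} (s t : 'S_n) :
  (forall i j : 'I_n, i < j -> (s i < s j) = (t i < t j)) -> s = t.
Proof.
move=> st.
have lt_st (i j : 'I_n) : (s i < s j) = (t i < t j).
  have := st i j; have := st j i; have := perm_nat_eq s i j.
  have := perm_nat_eq t i j; lia.
(* Values start at 0, so a letter equals the number of smaller letters, which the comparisons
   determine. *)
have rank (u : 'S_n) i : #|[set j : 'I_n | u j < u i]| = u i.
  have -> : [set j : 'I_n | u j < u i] = u @^-1: [set x : 'I_n | x < u i].
    by apply/setP => j; rewrite !inE.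
  rewrite card_preimset; last exact: perm_inj.
  rewrite -sum1dep_card (big_ord_narrow (ltnW (ltn_ord (u i)))).
  by rewrite sum1_card card_ord.
apply/permP => i; apply: val_inj; rewrite /= -(rank s) -(rank t).
by apply: eq_card => j; rewrite !inE lt_st.
Qed.

Lemma perm_of_nat_fun {n} (f : nat -> nat) :
  (forall i, i < n -> f i < n) ->
  (forall i j, i < j -> j < n -> f i <> f j) ->
  exists s : 'S_n, forall i : 'I_n, s i = f i :> nat.
Proof.
move=> fn f_inj; pose g (i : 'I_n) := Ordinal (fn i (ltn_ord i)).
have g_inj : injective g.
  move=> i j /(congr1 val) /= e; apply: val_inj => /=.
  have := f_inj i j; have := f_inj j i; have := ltn_ord i; have := ltn_ord j.
  by lia.
by exists (perm g_inj) => i; rewrite permE.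
Qed.

Lemma card_by_label {n} (A : {set 'S_n}) (label : 'S_n -> 'I_n) :
  {in A &, injective label} ->
  (forall p, exists2 s, s \in A & label s = p) -> #|A| = n.
Proof.
move=> inj surj; rewrite -(card_in_imset inj) -[RHS]card_ord.
rewrite -cardsT; congr #|pred_of_set _|; apply/setP => p; rewrite inE.
by have [s sA <-] := surj p; rewrite imset_f.
Qed.

(** The label is the position [p] of the least letter. Comparisons involving [p] are forced, and [c]
    prescribes all others, so [p] determines the permutation. *)
Lemma card_by_zero_position {m} (A : {set 'S_m.+1})
    (c : nat -> nat -> nat -> bool) :
  (forall (s : 'S_m.+1) (p i j : 'I_m.+1), s \in A -> s p = ord0 ->
     i < j -> i != p -> j != p -> (s i < s j) = c p i j) ->
  (forall p : 'I_m.+1, exists2 s, s \in A & s p = ord0) -> #|A| = m.+1.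
Proof.
move=> cmp surj.
apply: (@card_by_label _ A (fun s => s^-1%g ord0)) => [s t sA tA e | p]; last first.
  by have [s sA sp] := surj p; exists s; rewrite // -sp permK.
set p := s^-1%g ord0 in e.
have sp : s p = ord0 by rewrite permKV.
have tp : t p = ord0 by rewrite e permKV.
apply: perm_eq_of_comparisons => i j ij.
have [->|ip] := eqVneq i p.
  have := perm_nat_eq s p j; have := perm_nat_eq t p j; rewrite sp tp /=.
  have [->|] := eqVneq j p; first by rewrite sp tp.
  by rewrite -val_eqE /=; lia.
have [->|jp] := eqVneq j p; first by rewrite sp tp !ltn0.
by rewrite !(cmp _ p).
Qed.

Lemma classical_avoiders3P {n} {s : 'S_n} {u v w} :
  reflect [/\ avoids_classical n s u, avoids_classical n s v
             & avoids_classical n s w]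
    (s \in classical_avoiders n [:: u; v; w]).
Proof. by rewrite inE /= andbT; apply: and3P. Qed.

(** * Enumeration of the four classical classes *)

Lemma card_avoiders_123_213_312 m :
  #|classical_avoiders m.+1 [:: [:: 1; 2; 3]; [:: 2; 1; 3]; [:: 3; 1; 2]]| = m.+1.
Proof.
(* An ascent after the first letter would form 312, 213 or 123 with it, according to whether the
   first letter is above, between or below the two. *)
have tail (s : 'S_m.+1) (i j : 'I_m.+1) :
    s \in classical_avoiders m.+1 [:: [:: 1; 2; 3]; [:: 2; 1; 3]; [:: 3; 1; 2]] ->
    0 < i -> i < j -> s j < s i.
  case/classical_avoiders3P => /avoids_classicalP a1 /avoids_classicalP a2.
  move=> /avoids_classicalP a3 i0 ij.
  have := a1 ord0 i j; have := a2 ord0 i j; have := a3 ord0 i j.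
  rewrite !order_iso3E i0 ij.
  have := perm_nat_eq s ord0 i; have := perm_nat_eq s ord0 j.
  have := perm_nat_eq s i j; rewrite /=; lia.
apply: (@card_by_label _ _ (fun s => s ord0)) => [s t sA tA e | p]; last first.
  (* The witness is [p] followed by the other values in decreasing order; the second case of the
     formula lists those above [p], the third those below. *)
  have [||s sE] := @perm_of_nat_fun m.+1
    (fun i => if i == 0 then p : nat else if i + p <= m then m.+1 - i else m - i).
  - by move=> i; have := ltn_ord p; do !case: ifP; lia.
  - by move=> i j; have := ltn_ord p; do !case: ifP; lia.
  exists s; last by apply: val_inj; rewrite [LHS]sE.
  apply/classical_avoiders3P; split; apply/avoids_classicalP => i j k ij jk;
    rewrite order_iso3E !sE; have := ltn_ord k; do !case: ifP; lia.
(* For values [x < y], [x] stands before [y] exactly when [x] is the first letter. Thus the first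
   letter fixes all comparisons of the inverse. *)
have inv_cmp (u : 'S_m.+1) (x y : 'I_m.+1) :
    u \in classical_avoiders m.+1 [:: [:: 1; 2; 3]; [:: 2; 1; 3]; [:: 3; 1; 2]] ->
    u ord0 = s ord0 ->
    x < y -> (u^-1%g x < u^-1%g y) = (x == s ord0).
  move=> uA u0 xy.
  have x_eq : (u^-1%g x == 0 :> nat) = (x == s ord0).
    by rewrite -u0 -{2}(permKV u x) (inj_eq perm_inj).
  have := perm_nat_eq u^-1%g x y; rewrite -x_eq /=.
  have := tail u (u^-1%g x) (u^-1%g y) uA; rewrite !permKV; lia.
apply: invg_inj; apply: perm_eq_of_comparisons => x y xy.
by rewrite !inv_cmp.
Qed.

Lemma card_avoiders_123_213_231 m :
  #|classical_avoiders m.+1 [:: [:: 1; 2; 3]; [:: 2; 1; 3]; [:: 2; 3; 1]]| = m.+1.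
Proof.
(* An ascent among the other letters forms 123, 213 or 231 with the 0 before, between or after it.
   The witness is therefore decreasing apart from a 0 inserted at [p]. *)
apply: (@card_by_zero_position _ _ (fun p i j => false)) => [s p i j | p].
  case/classical_avoiders3P => /avoids_classicalP a1 /avoids_classicalP a2.
  move=> /avoids_classicalP a3 sp ij; rewrite -!val_eqE /= => ip jp.
  have := a1 p i j; have := a2 i p j; have := a3 i j p.
  rewrite !order_iso3E sp /=.
  have := perm_nat_eq s i p; have := perm_nat_eq s j p; rewrite sp /=.
  have := perm_nat_eq s i j; lia.
have [||s sE] := @perm_of_nat_fun m.+1
  (fun i => if i < p then m - i else if i == p then 0 else m.+1 - i).
- by move=> i; do !case: ifP; lia.
- by move=> i j; have := ltn_ord p; do !case: ifP; lia.
exists s; last by apply: val_inj; rewrite [LHS]sE ltnn eqxx.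
apply/classical_avoiders3P; split; apply/avoids_classicalP => i j k ij jk;
  rewrite order_iso3E !sE; have := ltn_ord k; have := ltn_ord p; do !case: ifP; lia.
Qed.

Lemma card_avoiders_123_231_312 m :
  #|classical_avoiders m.+1 [:: [:: 1; 2; 3]; [:: 2; 3; 1]; [:: 3; 1; 2]]| = m.+1.
Proof.
(* Avoiding 231 and 123 makes each side of the 0 decreasing; avoiding 312 puts the left side below
   the right. The witness is [p, ..., 0, m, ..., p+1]. *)
apply: (@card_by_zero_position _ _ (fun p i j => i < p < j)) => [s p i j | p].
  case/classical_avoiders3P => /avoids_classicalP a1 /avoids_classicalP a2.
  move=> /avoids_classicalP a3 sp ij; rewrite -!val_eqE /= => ip jp.
  have := a1 p i j; have := a2 i j p; have := a3 i p j.
  rewrite !order_iso3E sp /=.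
  have := perm_nat_eq s i p; have := perm_nat_eq s j p; rewrite sp /=.
  have := perm_nat_eq s i j; lia.
have [||s sE] := @perm_of_nat_fun m.+1
  (fun i => if i <= p then p - i else m.+1 + p - i).
- by move=> i; have := ltn_ord p; do !case: ifP; lia.
- by move=> i j; have := ltn_ord p; do !case: ifP; lia.
exists s; last by apply: val_inj; rewrite [LHS]sE leqnn subnn.
apply/classical_avoiders3P; split; apply/avoids_classicalP => i j k ij jk;
  rewrite order_iso3E !sE; have := ltn_ord k; have := ltn_ord p; do !case: ifP; lia.
Qed.

Lemma card_avoiders_132_213_231 m :
  #|classical_avoiders m.+1 [:: [:: 1; 3; 2]; [:: 2; 1; 3]; [:: 2; 3; 1]]| = m.+1.
Proof.
(* Only pairs to the right of the 0 ascend: 132 forbids descents there, while 213 and 231 forbid the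
   other ascents. The witness is [m, ..., m-p+1, 0, 1, ..., m-p]. *)
apply: (@card_by_zero_position _ _ (fun p i j => p < i)) => [s p i j | p].
  case/classical_avoiders3P => /avoids_classicalP a1 /avoids_classicalP a2.
  move=> /avoids_classicalP a3 sp ij; rewrite -!val_eqE /= => ip jp.
  have := a1 p i j; have := a2 i p j; have := a3 i j p.
  rewrite !order_iso3E sp /=.
  have := perm_nat_eq s i p; have := perm_nat_eq s j p; rewrite sp /=.
  have := perm_nat_eq s i j; lia.
have [||s sE] := @perm_of_nat_fun m.+1 (fun i => if i < p then m - i else i - p).
- by move=> i; do !case: ifP; lia.
- by move=> i j; have := ltn_ord p; do !case: ifP; lia.
exists s; last by apply: val_inj; rewrite [LHS]sE ltnn subnn.
apply/classical_avoiders3P; split; apply/avoids_classicalP => i j k ij jk;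
  rewrite order_iso3E !sE; have := ltn_ord k; have := ltn_ord p; do !case: ifP; lia.
Qed.

(** * Reduction of the twenty sets to the four classes *)

Lemma avoiders_eq_classical n (P : seq gpattern) (u v w : seq nat) :
  all (fun p => underlying p \in [:: u; v; w]) P ->
  (forall s : 'S_n, all (fun p => ~~ contains s p) P ->
     [/\ avoids_classical n s u, avoids_classical n s v
       & avoids_classical n s w]) ->
  avoiders n P = classical_avoiders n [:: u; v; w].
Proof.
move=> PV avV; apply/setP => s; rewrite [LHS]inE; apply/idP/idP.
  by move/avV/classical_avoiders3P.
by rewrite inE => /allP avs; apply: sub_all PV => p /avs; apply: avoids_underlying.
Qed.

(* Keeps [simpl] and unification from unfolding the quantifiers over ['I_n]. *)
Arguments contains : simpl never.
Opaque contains avoids_classical.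

Ltac avoids_direct :=
  first [ apply avoids_213; assumption | apply avoids_231; assumption
        | apply avoids_312; assumption | apply avoids_132; assumption ].

(** One level of derivation suffices: the auxiliary classical pattern always comes from one of the
    four direct lemmas. *)
Ltac avoids_from lem := apply lem; [ avoids_direct | assumption ].

Ltac avoids_derived :=
  first
    [ avoids_direct
    | avoids_from avoids_123_of_213 | avoids_from avoids_123_of_231
    | avoids_from avoids_123_of_312 | avoids_from avoids_132_of_231
    | avoids_from avoids_231_of_213 | avoids_from avoids_213_of_231
    | avoids_from avoids_213_of_312 | avoids_from avoids_312_of_213
    | avoids_from avoids_312_of_231 ].

Ltac reduce_to lem :=
  rewrite -[RHS]lem; congr #|pred_of_set _|; apply: avoiders_eq_classical;
  [ by []
  | move=> s /= /and5P[? ? ? ? /andP[? _]];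
    split; avoids_derived ].

Theorem mainTheorem15 :
  forall P : seq gpattern,
    List.In P [::
     [:: [gp 1 - 2 3]; [gp 2 - 1 3]; [gp 3 1 - 2]; [gp 2 1 - 3]; [gp 3 - 1 2]];
     [:: [gp 1 - 2 3]; [gp 2 - 1 3]; [gp 2 - 3 1]; [gp 2 1 - 3]; [gp 2 3 - 1]];
     [:: [gp 1 2 - 3]; [gp 3 1 - 2]; [gp 2 - 1 3]; [gp 2 1 - 3]; [gp 3 - 1 2]];
     [:: [gp 1 - 2 3]; [gp 2 - 3 1]; [gp 3 1 - 2]; [gp 2 3 - 1]; [gp 3 - 1 2]];
     [:: [gp 2 - 1 3]; [gp 2 - 3 1]; [gp 1 - 3 2]; [gp 2 3 - 1]; [gp 2 1 - 3]];
     [:: [gp 2 - 1 3]; [gp 2 - 3 1]; [gp 1 3 - 2]; [gp 2 3 - 1]; [gp 2 1 - 3]];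
     [:: [gp 2 - 1 3]; [gp 2 - 3 1]; [gp 1 3 - 2]; [gp 2 1 - 3]; [gp 1 - 3 2]];
     [:: [gp 2 - 1 3]; [gp 2 3 - 1]; [gp 1 3 - 2]; [gp 1 - 3 2]; [gp 2 1 - 3]];
     [:: [gp 2 - 1 3]; [gp 2 - 3 1]; [gp 1 3 - 2]; [gp 1 - 3 2]; [gp 2 3 - 1]];
     [:: [gp 2 - 3 1]; [gp 2 1 - 3]; [gp 1 3 - 2]; [gp 2 3 - 1]; [gp 1 - 3 2]];
     [:: [gp 1 - 2 3]; [gp 2 - 1 3]; [gp 2 - 3 1]; [gp 2 1 - 3]; [gp 1 2 - 3]];
     [:: [gp 1 - 2 3]; [gp 2 - 1 3]; [gp 2 3 - 1]; [gp 2 1 - 3]; [gp 1 2 - 3]];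
     [:: [gp 1 - 2 3]; [gp 2 - 1 3]; [gp 3 - 1 2]; [gp 2 1 - 3]; [gp 1 2 - 3]];
     [:: [gp 1 - 2 3]; [gp 2 - 1 3]; [gp 3 1 - 2]; [gp 2 1 - 3]; [gp 1 2 - 3]];
     [:: [gp 1 - 2 3]; [gp 2 - 1 3]; [gp 2 - 3 1]; [gp 2 3 - 1]; [gp 1 2 - 3]];
     [:: [gp 1 - 2 3]; [gp 2 - 1 3]; [gp 3 1 - 2]; [gp 3 - 1 2]; [gp 1 2 - 3]];
     [:: [gp 1 - 2 3]; [gp 2 1 - 3]; [gp 2 - 3 1]; [gp 2 3 - 1]; [gp 1 2 - 3]];
     [:: [gp 1 - 2 3]; [gp 2 1 - 3]; [gp 3 1 - 2]; [gp 3 - 1 2]; [gp 1 2 - 3]];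
     [:: [gp 1 - 2 3]; [gp 2 - 3 1]; [gp 3 - 1 2]; [gp 2 3 - 1]; [gp 1 2 - 3]];
     [:: [gp 1 - 2 3]; [gp 2 - 3 1]; [gp 3 1 - 2]; [gp 2 3 - 1]; [gp 1 2 - 3]] ] ->
  forall n : nat, 1 <= n -> #|avoiders n P| = n.
Proof.
move=> P inP [//|m] _; move: inP.
do 20!(case=> [<-|];
  (* The class of each set is found by trial, since a pattern foreign to the class makes the
     reduction fail. *)
  [ first [ reduce_to card_avoiders_123_213_312
          | reduce_to card_avoiders_123_213_231
          | reduce_to card_avoiders_123_231_312
          | reduce_to card_avoiders_132_213_231 ] | ]).
by [].
Qed.
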